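(* Let $\mathcal{X}=(X,d_X,f_X)$ be a finite augmented metric space and let $M:=\mathrm{H}_0(\mathcal{R}^{\mathrm{bi}}_\bullet(\mathcal{X})):\mathbb{R}^2\to\mathbf{Vec}$. Let $\mathcal{I}_{\mathcal{X}}=\{\!\{I_x : x\in X\}\!\}$ be an elder-rule-staircode of $\mathcal{X}$ (with respect to any total order on $X$ compatible with $f_X$). Then for each line $L\subset\mathbb{R}^2$ of strictly positive slope, the barcode $\mathbf{barc}(M|_L)$ coincides, up to removal of empty sets, with the multiset $\{\!\{L\cap I_x : x\in X\}\!\}$.
   Context: **Augmented metric spaces and Rips bifiltration.** A finite augmented metric space is a triple $\mathcal{X}=(X,d_X,f_X)$ with $(X,d_X)$ a finite metric space and $f_X:X\to\mathbb{R}$ a function. For $\sigma\in\mathbb{R}$ put $X_\sigma=\{x\in X: f_X(x)\le\sigma\}$. For $\varepsilon\in\mathbb{R}$, $\mathcal{R}_\varepsilon(X_\sigma,d_X)$ is the abstract simplicial complex whose simplices are the nonempty $A\subseteq X_\sigma$ with $d_X(a,a')\le\varepsilon$ for all $a,a'\in A$ (so it is empty for $\varepsilon<0$). The Rips bifiltration $\mathcal{R}^{\mathrm{bi}}_\bullet(\mathcal{X})$ is the functor on $\mathbb{R}^2$ (with the product order) sending $(\sigma,\varepsilon)$ to $\mathcal{R}_\varepsilon(X_\sigma,d_X)$, with inclusions as internal maps. $\mathrm{H}_0$ is simplicial homology with coefficients in a fixed field $\mathbb{F}$, and $\mathbf{Vec}$ is the category of finite-dimensional $\mathbb{F}$-vector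 spaces. **Elder-rule-staircode.** For $\varepsilon\ge 0$ and $x\in X_\sigma$, $[x]_{(\sigma,\varepsilon)}$ is the set of all $x'\in X_\sigma$ for which there is a sequence $x=x_1,\dots,x_\ell=x'$ in $X_\sigma$ with $d_X(x_i,x_{i+1})\le\varepsilon$ for all $i$. A total order $<$ on $X$ is compatible with $f_X$ if $f_X(x)<f_X(x')$ implies $x<x'$. For such an order, $I_x=I_x^<:=\{(\sigma,\varepsilon)\in\mathbb{R}^2:\varepsilon\ge 0,\ x\in X_\sigma,\ x=\min([x]_{(\sigma,\varepsilon)},<)\}$; the multiset $\{\!\{I_x^<:x\in X\}\!\}$ is an elder-rule-staircode of $\mathcal{X}$. **Barcodes.** For a poset $\mathbb{P}$, an interval $\mathcal{J}\subseteq\mathbb{P}$ is a nonempty, convex ($a,b\in\mathcal{J}$, $a\le c\le b$ imply $c\in\mathcal{J}$) subset in which any two elements are joined by a finite sequence of elements of $\mathcal{J}$ with consecutive elements comparable. The interval module $I^{\mathcal{J}}$ is $\mathbb{F}$ on $\mathcal{J}$ with identity internal maps within $\mathcal{J}$, and $0$ elsewhere. If $N:\mathbb{P}\to\mathbf{Vec}$ satisfies $N\cong\bigoplus_{\mathcal{J}\in B}I^{\mathcal{J}}$ for a multiset $B$ of intervals, then $B=:\mathbf{barc}(N)$ is the barcode of $N$ (it is unique). For a line $L$ of positive slope, $L$ is a totally ordered set with the order inherited from $\mathbb{R}^2$, and $M|_L:L\to\mathbf{Vec}$ is the restriction, which is always interval decomposable. *)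

(* Defs.v *)
From HB Require Import structures.
From mathcomp Require Import all_boot all_order all_algebra.
From mathcomp Require Import boolp classical_sets reals.
From mathcomp Require Import topology_structure uniform_structure.
From mathcomp Require Import pseudometric_structure metric_structure.

Set Implicit Arguments.
Unset Strict Implicit.
Unset Printing Implicit Defensive.

Import Order.TTheory GRing.Theory Num.Theory.

Local Open Scope classical_set_scope.
Local Open Scope ring_scope.

(* Quotients of subspaces. The quotient U / W (for W <= U) is carried by the
   complement U :\: W of W in U; [quotv_pi] is the projection onto it along W.
   [quotv_pi_surj] and [quotv_pi_eq0] are its defining properties, and
   [quotv_map_pi] that of the map U / W -> U' / W' induced by inclusions. *)
Section Quotients.
Variables (F : fieldType) (vT : vectType F).
Implicit Types U W : {vspace vT}.

Definition quotv U W : vectType F := subvs_of (U :\: W)%VS.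

Definition quotv_pi U W : 'Hom(vT, quotv U W) :=
  (linfun (vsproj (U :\: W)%VS) \o addv_pi1 U W)%VF.

Definition quotv_map U W U' W' : 'Hom(quotv U W, quotv U' W') :=
  (quotv_pi U' W' \o linfun (@vsval F vT (U :\: W)%VS))%VF.

Lemma val_quotv_pi U W u : vsval (quotv_pi U W u) = addv_pi1 U W u.
Proof. by rewrite comp_lfunE lfunE /= vsprojK // memv_pi. Qed.

Lemma quotv_pi_val U W (z : quotv U W) : quotv_pi U W (vsval z) = z.
Proof.
apply: val_inj; rewrite /= val_quotv_pi.
exact: (daddv_pi_id (capv_diff U W) (subvsP z)).
Qed.

Lemma quotv_pi_surj U W (z : quotv U W) : exists2 u, u \in U & quotv_pi U W u = z.
Proof.
exists (vsval z); last exact: quotv_pi_val.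
exact: (subvP (diffvSl U W)) (subvsP z).
Qed.

Lemma quotv_pi_ker U W w : w \in W -> quotv_pi U W w = 0.
Proof.
move=> Ww; apply: val_inj; rewrite /= val_quotv_pi.
have := @addv_pi1_pi2 _ _ U W w; rewrite (addv_pi2_id U Ww) => e.
by apply: (addIr w); rewrite add0r e // (subvP (addvSr U W)).
Qed.

Lemma quotv_pi_sub U W u : u \in U -> u - vsval (quotv_pi U W u) \in W.
Proof.
move=> Uu; have := @addv_pi1_pi2 _ _ U W u.
rewrite (subvP (addvSl U W)) // => /(_ isT) {1}<-.
by rewrite val_quotv_pi addrAC subrr add0r memv_pi2.
Qed.

Lemma quotv_pi_eq0 U W u : u \in U -> (quotv_pi U W u == 0) = (u \in W).
Proof.
move=> Uu; apply/eqP/idP => [e|]; last exact: quotv_pi_ker.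
by have := quotv_pi_sub W Uu; rewrite e /= subr0.
Qed.

Lemma quotv_map_pi U W U' W' u : (W <= W')%VS -> u \in U ->
  quotv_map U W U' W' (quotv_pi U W u) = quotv_pi U' W' u.
Proof.
move=> WW' Uu; rewrite comp_lfunE [X in quotv_pi _ _ X]lfunE /=.
apply/esym/eqP; rewrite -subr_eq0 -raddfB /=; apply/eqP/quotv_pi_ker.
exact: (subvP WW') (quotv_pi_sub W Uu).
Qed.

End Quotients.

(* The sub-poset structure on a subset of a poset. *)
HB.instance Definition _ d (P : porderType d) (A : set P) :=
  [SubChoice_isSubPOrder of {p : P | p \in A} by <: with d].

(* Functors from a poset to finite-dimensional vector spaces. *)
Record pmod (F : fieldType) d (P : porderType d) := PMod {
  pmod_obj :> P -> vectType F;
  pmod_map : forall p q : P, (p <= q)%O -> 'Hom(pmod_obj p, pmod_obj q);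
  pmod_map_id : forall (p : P) (pp : (p <= p)%O), pmod_map pp = \1%VF;
  pmod_map_comp : forall (p q r : P) (pq : (p <= q)%O) (qr : (q <= r)%O)
    (pr : (p <= r)%O), pmod_map pr = (pmod_map qr \o pmod_map pq)%VF
}.

Section PersistenceModules.
Variables (F : fieldType) (d : Order.disp_t) (P : porderType d).
Implicit Types M N : pmod F P.

Definition pmod_iso M N : Prop :=
  exists phi : forall p, 'Hom(M p, N p),
    (forall p, bijective (phi p)) /\
    (forall (p q : P) (pq : (p <= q)%O),
       (phi q \o pmod_map M pq = pmod_map N pq \o phi p)%VF).

Definition pmod_restr M (A : set P) : pmod F {p : P | p \in A} :=
  @PMod F d {p : P | p \in A} (fun p => M (val p))
    (fun p q (pq : (p <= q)%O) => pmod_map M (pq : (val p <= val q)%O))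
    (fun p _ => pmod_map_id M _) (fun p q r _ _ _ => pmod_map_comp M _ _ _).

Definition pmod0 : pmod F P.
Proof.
refine (@PMod F d P (fun=> 'rV[F]_0) (fun p q _ => 0) _ _).
- by move=> p pp; apply/lfunP => v; apply/rowP; case.
- by move=> p q r pq qr pr; apply/lfunP => v; apply/rowP; case.
Defined.

Section BinarySum.
Variables M N : pmod F P.

Definition pmod_sum_fun (p q : P) (pq : (p <= q)%O) (z : M p * N p) :
  M q * N q := (pmod_map M pq z.1, pmod_map N pq z.2).

Fact pmod_sum_fun_linear p q pq : linear (@pmod_sum_fun p q pq).
Proof. by move=> a y z; rewrite /pmod_sum_fun !linearP. Qed.

HB.instance Definition _ p q pq :=
  GRing.isLinear.Build F (M p * N p)%type (M q * N q)%type _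
    (@pmod_sum_fun p q pq) (@pmod_sum_fun_linear p q pq).

Definition pmod_sum : pmod F P.
Proof.
refine (@PMod F d P (fun p => (M p * N p)%type)
  (fun p q pq => linfun (@pmod_sum_fun p q pq)) _ _).
- move=> p pp; apply/lfunP => -[y z].
  by rewrite !lfunE /= /pmod_sum_fun !pmod_map_id !lfunE.
- move=> p q r pq qr pr; apply/lfunP => -[y z].
  rewrite comp_lfunE !lfunE /= /pmod_sum_fun /=.
  by rewrite (pmod_map_comp M pq qr) (pmod_map_comp N pq qr) !comp_lfunE.
Defined.

End BinarySum.

Definition pmod_bigsum (s : seq (pmod F P)) : pmod F P :=
  foldr pmod_sum pmod0 s.

End PersistenceModules.

Arguments pmod0 {F d P}.

Section Barcodes.
Variables (F : fieldType) (d : Order.disp_t) (P : porderType d).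

Definition is_interval (J : set P) : Prop :=
  [/\ J !=set0,
      forall a b c, J a -> J b -> (a <= c)%O -> (c <= b)%O -> J c
    & forall a b, J a -> J b -> exists s : seq P,
        [/\ forall c, c \in s -> J c, path >=<%O a s & last a s = b]].

Record interval := Interval {
  interval_set :> set P;
  intervalP : is_interval interval_set
}.

(* The dimension is the boolean p \in J, so the space at p is F if p \in J and
   0 otherwise; [const_mx 1] is then the 1 x 1 identity matrix when both ends
   lie in J, and an empty matrix otherwise. *)
Definition interval_module (J : interval) : pmod F P.
Proof.
refine (@PMod F d P (fun p => 'rV[F]_(p \in (J : set P)))
  (fun p q _ => linfun (mulmxr (const_mx 1))) _ _).
- move=> p pp; apply/lfunP => v; rewrite !lfunE /=.
  move: v; case: (p \in _) => v; apply/rowP => i; last by case: i.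
  by rewrite mxE big_ord1 mxE mulr1 !ord1.
- move=> p q r pq qr pr; apply/lfunP => v; rewrite comp_lfunE !lfunE /=.
  have : p \in (J : set P) -> r \in (J : set P) -> q \in (J : set P).
    rewrite !inE; have [_ cvxJ _] := intervalP J.
    by move=> Jp Jr; exact: cvxJ Jp Jr pq qr.
  move: v; case: (p \in _) => v.
    case: (r \in _) => [/(_ isT isT) ->|_]; last by apply/rowP; case.
    by apply/rowP => i; rewrite !mxE !big_ord1 !mxE big_ord1 !mxE !mulr1.
  by move=> _; rewrite (thinmx0 v) !mul0mx.
Defined.

(* [is_barcode M B]: the sequence B lists the members, with multiplicity, of
   the multiset barc(M). Sequences are multisets up to [perm_eq]. *)
Definition is_barcode (M : pmod F P) (B : seq (set P)) : Prop :=
  exists s : seq interval,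
    perm_eq B [seq interval_set J | J <- s] /\
    pmod_iso M (pmod_bigsum [seq interval_module J | J <- s]).

End Barcodes.

Record simplicial_complex (X : finType) := SimplicialComplex {
  simplices :> {set {set X}};
  simplex_neq0 : forall A, A \in simplices -> A != finset.set0;
  simplex_face : forall A B : {set X}, A \in simplices ->
    B \subset A -> B != finset.set0 -> B \in simplices
}.

Fact index_filterC (T : eqType) (s : seq T) (a b : T) : uniq s -> b != a ->
  a \in s -> b \in s ->
  (index b [seq x <- s | x != a] + (index a s < index b s) = index b s)%N.
Proof.
move=> + ba; elim: s => //= x s IH /andP[xs us]; rewrite !inE.
case: (eqVneq a x) => [e|ax] /=.
  subst x; rewrite (negPf ba) eq_sym (negPf ba) /= => _ bs; rewrite addn1; congr _.+1.
  congr index; apply/all_filterP/allP => y ys; apply: contraNneq xs => <-.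
  by [].
case: (eqVneq b x) => [->|bx] /= as_ bs.
  by [].
by rewrite ltnS addSn IH.
Qed.

Section Homology.
Variables (F : fieldType) (X : finType).

(* All simplicial chains on the vertex set X, with a simplex A standing for the
   oriented simplex [a_0, ..., a_n] where enum A = [:: a_0; ...; a_n]. *)
Definition chain : vectType F := {ffun {set X} -> F^o}.

Definition simplex_chain (A : {set X}) : chain := [ffun B => (B == A)%:R].

(* The boundary of a vertex is 0 (homology is not reduced). *)
Definition simplex_boundary (A : {set X}) : chain :=
  if (#|A| <= 1)%N then 0
  else \sum_(a in A) (-1) ^+ index a (enum A) *: simplex_chain (A :\ a)%SET.

Definition boundary_fun (c : chain) : chain :=
  \sum_(A : {set X}) (c : {ffun {set X} -> F^o}) A *: simplex_boundary A.

Fact boundary_fun_linear : linear boundary_fun.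
Proof.
move=> a c c'; rewrite /boundary_fun scaler_sumr -big_split /=.
by apply: eq_bigr => A _; rewrite !ffunE scalerDl scalerA.
Qed.

HB.instance Definition _ :=
  GRing.isLinear.Build F chain chain _ boundary_fun boundary_fun_linear.

Definition boundary : 'End(chain) := linfun boundary_fun.

Fact index_enumD (A : {set X}) a b : a \in A -> b \in (A :\ a)%SET ->
  (index b (enum (A :\ a)%SET) + (index a (enum A) < index b (enum A)) = index b (enum A))%N.
Proof.
rewrite !inE => aA /andP[ba bA].
rewrite -[RHS](@index_filterC _ (enum A) a b) ?enum_uniq ?mem_enum //.
congr (index _ _ + _)%N; rewrite {1 2}/enum_mem -filter_predI.
by apply: eq_filter => x; rewrite !inE.
Qed.

Fact boundary_simplex A : boundary (simplex_chain A) = simplex_boundary A.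
Proof.
rewrite lfunE /= /boundary_fun (bigD1 A) //= big1 => [|B BA]; rewrite ffunE.
  by rewrite eqxx scale1r addr0.
by rewrite (negPf BA) scale0r.
Qed.

Fact boundary_boundary c : boundary (boundary c) = 0.
Proof.
rewrite [boundary c]lfunE /= /boundary_fun linear_sum big1 // => A _.
rewrite linearZ /=; apply/eqP; rewrite scaler_eq0; apply/orP; right; apply/eqP.
rewrite {1}/simplex_boundary; case: ifP => [_|A1]; first by rewrite linear0.
rewrite linear_sum; under eq_bigr => a aA do rewrite linearZ /= boundary_simplex.
have [A2|A2] := boolP (#|A| <= 2)%N.
  rewrite big1 // => a aA; rewrite /simplex_boundary.
  by move: A2; rewrite (cardsD1 a) aA add1n ltnS => ->; rewrite scaler0.
pose f a b : chain := (-1) ^+ index a (enum A) *: ((-1) ^+ index b (enum (A :\ a)%SET) *: simplex_chain (A :\ a :\ b)%SET).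
transitivity (\sum_(a in A) \sum_(b in A | b != a) f a b).
  apply: eq_bigr => a aA; rewrite /simplex_boundary.
  move: A2; rewrite (cardsD1 a) aA add1n ltnS => /negPf ->.
  by rewrite scaler_sumr; apply: eq_bigl => b; rewrite !inE andbC.
pose g a := index a (enum A).
transitivity (\sum_(a in A) (\sum_(b in A | (g b < g a)%N) f a b + \sum_(b in A | (g a < g b)%N) f a b)).
  apply: eq_bigr => a aA; rewrite (bigID (fun b => (g b < g a)%N)) /=.
  have gn b : b \in A -> (g b == g a) = (b == a).
    move=> bA; apply/eqP/eqP => [|-> //].
    by move=> e; rewrite -[b](nth_index a (s := enum A)) ?mem_enum // -/(g b) e nth_index ?mem_enum.
  congr (_ + _); apply: eq_bigl => b; case bA: (b \in A) => //=; rewrite -(gn b bA).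
    by rewrite neq_ltn; case: ltngtP.
  by rewrite neq_ltn; case: ltngtP.
rewrite big_split /= (exchange_big_dep (mem A)) /=; last by move=> ? ? _ /andP[].
rewrite -big_split big1 //= => a aA; apply/eqP.
rewrite (eq_bigl (fun b => (b \in A) && (g a < g b)%N)); last first.
  by move=> b; rewrite aA.
rewrite -big_split big1 //= => b /andP[bA ab].
have ba : b != a by apply: contraTneq ab => ->; rewrite ltnn.
rewrite /f !scalerA -!exprD.
have <- : (A :\ a :\ b = A :\ b :\ a)%SET by apply/setP => x; rewrite !inE andbCA.
rewrite -scalerDl -/(g a) -/(g b).
have := @index_enumD A b a bA; have := @index_enumD A a b aA.
rewrite -/(g a) -/(g b) !inE ba eq_sym ba aA bA => /(_ isT) e1 /(_ isT).
rewrite ltnNge (ltnW ab) addn0 => ->.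
by rewrite -[in X in X + _]e1 ab addn1 addSn exprS mulN1r addnC addNr scale0r.
Qed.

Implicit Types K L : {set {set X}}.

Definition chains (n : nat) K : {vspace chain} :=
  <<[seq simplex_chain A | A : {set X} <- enum K & #|A| == n.+1]>>%VS.

Definition cycles (n : nat) K : {vspace chain} :=
  (chains n K :&: lker boundary)%VS.

Definition boundaries (n : nat) K : {vspace chain} :=
  (boundary @: chains n.+1 K)%VS.

Fact boundaries_cycles n (K : simplicial_complex X) :
  (boundaries n K <= cycles n K)%VS.
Proof.
rewrite subv_cap; apply/andP; split; last first.
  apply/subvP => _ /memv_imgP[c _ ->].
  by rewrite memv_ker; apply/eqP; exact: boundary_boundary.
rewrite /boundaries /chains limg_span; apply/span_subvP => _ /mapP[_ /mapP[A + ->] ->].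
rewrite mem_filter mem_enum boundary_simplex => /andP[/eqP An KA].
rewrite /simplex_boundary An; apply: memv_suml => a aA.
apply/memvZ/memv_span/map_f; rewrite mem_filter mem_enum.
have An' : #|A :\ a|%SET == n.+1 by move: An; rewrite (cardsD1 a) aA => -[/= <-].
rewrite An' (simplex_face KA) ?subD1set //.
by apply: contraTneq An' => ->; rewrite cards0.
Qed.

Definition homology (n : nat) (K : simplicial_complex X) : vectType F :=
  quotv (cycles n K) (boundaries n K).

Definition homology_map (n : nat) (K L : simplicial_complex X) :
    'Hom(homology n K, homology n L) :=
  quotv_map (cycles n K) (boundaries n K) (cycles n L) (boundaries n L).

Lemma chainsS n K L : K \subset L -> (chains n K <= chains n L)%VS.
Proof.
move=> /fintype.subsetP KL; apply: sub_span => c /mapP[A].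
rewrite mem_filter mem_enum => /andP[An KA] ->.
by apply: map_f; rewrite mem_filter mem_enum An KL.
Qed.

Lemma cyclesS n K L : K \subset L -> (cycles n K <= cycles n L)%VS.
Proof. by move=> KL; apply: capvS => //; apply: chainsS. Qed.

Lemma boundariesS n K L : K \subset L -> (boundaries n K <= boundaries n L)%VS.
Proof. by move=> KL; apply/limgS/chainsS. Qed.

End Homology.

(* Functors from a poset to simplicial complexes on a fixed vertex set whose
   internal maps are inclusions. *)
Record filtration (X : finType) d (P : porderType d) := Filtration {
  filtration_obj :> P -> simplicial_complex X;
  filtration_sub : forall p q : P, (p <= q)%O ->
    filtration_obj p \subset filtration_obj q
}.

Definition homology_pmod (F : fieldType) (X : finType) d (P : porderType d)
  (n : nat) (K : filtration X P) : pmod F P.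
Proof.
refine (@PMod F d P (fun p => homology F n (K p))
  (fun p q _ => homology_map F n (K p) (K q)) _ _).
- move=> p pp; apply/lfunP => z; have [u Zu <-] := quotv_pi_surj z.
  by rewrite id_lfunE; apply: quotv_map_pi.
- move=> p q r pq qr pr; apply/lfunP => z; have [u Zu <-] := quotv_pi_surj z.
  have Kpq := filtration_sub K pq; have Kqr := filtration_sub K qr.
  rewrite comp_lfunE /homology_map !quotv_map_pi //; try exact: boundariesS.
  + exact: (subvP (cyclesS F n Kpq)).
  + by apply: boundariesS; exact: fintype.subset_trans Kpq Kqr.
Defined.

#[short(type="finMetricType")]
HB.structure Definition FinMetric (R : realType) :=
  {X of Finite X & Metric R X}.

Record augMetricSpace (R : realType) := AugMetricSpace {
  aug_carrier :> finMetricType R;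
  aug_fun : aug_carrier -> R
}.

Section RipsBifiltration.
Variables (R : realType) (X : augMetricSpace R).

Definition sublevel (sigma : R) : {set X} := [set x | aug_fun x <= sigma]%SET.

Definition rips_simplices (eps : R) (S : {set X}) : {set {set X}} :=
  [set A : {set X} | [&& A != finset.set0, A \subset S &
     [forall a in A, forall a' in A, mdist a a' <= eps]]]%SET.

Fact rips_neq0 eps S A : A \in rips_simplices eps S -> A != finset.set0.
Proof. by rewrite inE => /and3P[]. Qed.

Fact rips_face eps S (A B : {set X}) : A \in rips_simplices eps S ->
  B \subset A -> B != finset.set0 -> B \in rips_simplices eps S.
Proof.
rewrite !inE => /and3P[_ AS /'forall_in_forall_inP dA] BA ->.
rewrite (fintype.subset_trans BA AS) /=.
apply/'forall_in_forall_inP => a Ba a' Ba'.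
by apply: dA; apply: (fintype.subsetP BA).
Qed.

Definition rips (eps : R) (S : {set X}) : simplicial_complex X :=
  SimplicialComplex (@rips_neq0 eps S) (@rips_face eps S).

Fact rips_bi_sub (p q : R *p R) : (p <= q)%O ->
  rips p.2 (sublevel p.1) \subset rips q.2 (sublevel q.1).
Proof.
move=> /andP[p1q1 p2q2]; apply/fintype.subsetP => A; rewrite !inE.
move=> /and3P[-> /fintype.subsetP AS /'forall_in_forall_inP dA] /=.
apply/andP; split.
  by apply/fintype.subsetP => a /AS; rewrite !inE => /le_trans; apply.
by apply/'forall_in_forall_inP => a Aa a' Aa'; apply: le_trans (dA _ _ _ _) p2q2.
Qed.

Definition rips_bifiltration : filtration X (R *p R)%type :=
  @Filtration X _ (R *p R)%type (fun p => rips p.2 (sublevel p.1)) rips_bi_sub.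

End RipsBifiltration.

Section ElderRuleStaircode.
Variables (R : realType) (X : augMetricSpace R).

Definition strict_total_order (T : eqType) (lt : rel T) : Prop :=
  [/\ irreflexive lt, transitive lt
    & forall x y, x != y -> lt x y || lt y x].

Definition compatible (lt : rel X) : Prop :=
  forall x x' : X, aug_fun x < aug_fun x' -> lt x x'.

(* The class [x]_(sigma, eps), for x \in sublevel X sigma. *)
Definition block (sigma eps : R) (x : X) : {set X} :=
  [set x' | connect [rel a b | [&& a \in sublevel X sigma,
     b \in sublevel X sigma & mdist a b <= eps]] x x']%SET.

Definition stair (lt : rel X) (x : X) : set (R *p R) :=
  [set p : R *p R | [/\ 0 <= p.2, x \in sublevel X p.1
    & forall x', x' \in block p.1 p.2 x -> x' != x -> lt x x']].

Definition elder_rule_staircode (lt : rel X) : seq (set (R *p R)) :=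
  [seq stair lt x | x <- enum X].

End ElderRuleStaircode.

Definition positive_slope_line (R : realType) (L : set (R *p R)) : Prop :=
  exists m c : R, 0 < m /\ L = [set p : R *p R | p.2 = m * p.1 + c].

(* L `&` J, as a subset of the sub-poset L. *)
Definition slice (T : Type) (L J : set T) : set {p : T | p \in L} :=
  [set p | J (val p)].

Arguments slice {T} L J.

(* Main.v *)
From Pilot Require Import Defs.
From HB Require Import structures.
From mathcomp Require Import all_boot all_order all_algebra.
From mathcomp Require Import boolp classical_sets reals.
From mathcomp Require Import metric_structure.

(* Existence: on the line, attach to each vertex x the class [x] - [y], where y
   is an older vertex lying in the block of x wherever x has stopped being
   minimal there (or [x] alone if it never does). These classes vanish once x is
   no longer minimal, and at each point those of the minimal vertices differ
   from the basis of minimal vertices by a unitriangular change of basis.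
   Uniqueness: the rank of the map from p to q counts the bars containing p and
   q. By convexity this determines, for every nonempty finite set S of points,
   the number of bars containing S; inclusion-exclusion then gives the number of
   bars containing S and avoiding a finite set T, and suitable S and T separate
   a given bar from finitely many others. *)

Set Implicit Arguments.
Unset Strict Implicit.
Unset Printing Implicit Defensive.

Import Order.TTheory GRing.Theory Num.Theory.

Local Open Scope classical_set_scope.
Local Open Scope ring_scope.

(** * Rank invariant of sums of interval modules *)

Lemma linear_lfun (F : fieldType) (U V : vectType F) (f : U -> V) :
  linear f -> exists h : 'Hom(U, V), h =1 f.
Proof.
move=> fl; pose fL := GRing.isLinear.Build F U V _ f fl.
pose f' : {linear U -> V} := HB.pack f fL.
by exists (linfun f') => u; rewrite lfunE.
Qed.

(** Applied to the internal maps of [interval_module]; keeping the two memberships as boolean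
    variables lets them be destructed inside the dimensions. *)
Lemma dim_limg_const_mx (F : fieldType) (b c : bool) :
  \dim (limg (linfun (mulmxr (const_mx 1 : 'M[F]_(b, c)))
             : 'Hom('rV[F]_b, 'rV[F]_c))) = b && c.
Proof.
case: b; case: c; last first.
- by apply/eqP; rewrite -leqn0 (leq_trans (dimvS (subvf _))) // dimvf.
- have -> : linfun (mulmxr (const_mx 1)) = 0 :> 'Hom('rV[F]_0, 'rV[F]_1).
    by apply/lfunP => v; rewrite !lfunE (thinmx0 v) /= mul0mx.
  by rewrite lim0g dimv0.
- by apply/eqP; rewrite -leqn0 (leq_trans (dimvS (subvf _))) // dimvf.
have -> : linfun (mulmxr (const_mx 1)) = \1%VF :> 'End('rV[F]_1).
  apply/lfunP => v; rewrite !lfunE; apply/rowP => i.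
  by rewrite mxE big_ord1 mxE mulr1 !ord1.
by rewrite lim1g dimvf.
Qed.

Section Rank.
Variables (F : fieldType) (d : Order.disp_t) (P : porderType d).
Implicit Types M N : pmod F P.

Definition pmod_rank M p q (pq : (p <= q)%O) := \dim (limg (pmod_map M pq)).

(** The naturality square carries one image onto the other, because [phi p] is onto and [phi q] is
    injective. *)
Lemma pmod_rank_iso M N p q (pq : (p <= q)%O) :
  pmod_iso M N -> pmod_rank M pq = pmod_rank N pq.
Proof.
case=> phi [phi_bij phi_nat]; rewrite /pmod_rank.
have phi_im r : limg (phi r) = fullv.
  apply/vspaceP => v; rewrite memvf; have [psi _ psiK] := phi_bij r.
  by rewrite -[v]psiK memv_img ?memvf.
rewrite -[in RHS](phi_im p) -limg_comp -phi_nat limg_comp (limg_dim_eq (f := phi q)) //.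
have /eqP -> : lker (phi q) == 0%VS by apply/lker0P/bij_inj.
exact: capv0.
Qed.

Lemma pmod_rank0 p q (pq : (p <= q)%O) : pmod_rank (@pmod0 F d P) pq = 0%N.
Proof. by rewrite /pmod_rank /= lim0g dimv0. Qed.

(** The image is the internal direct sum of the two images, embedded along the coordinate injections
    [i] and [j]. *)
Lemma pmod_rank_sum M N p q (pq : (p <= q)%O) :
  pmod_rank (pmod_sum M N) pq = (pmod_rank M pq + pmod_rank N pq)%N.
Proof.
have [i iE] : exists h : 'Hom(M q, (M q * N q)%type), h =1 (fun u => (u, 0)).
  by apply: linear_lfun => a u v; congr pair; rewrite /= scaler0 addr0.
have [j jE] : exists h : 'Hom(N q, (M q * N q)%type), h =1 (fun v => (0, v)).
  by apply: linear_lfun => a u v; congr pair; rewrite /= scaler0 addr0.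
have i_inj : lker i = 0%VS.
  by apply/eqP/lker0P => u v; rewrite !iE => -[].
have j_inj : lker j = 0%VS.
  by apply/eqP/lker0P => u v; rewrite !jE => -[].
rewrite /pmod_rank -(limg_dim_eq (f := i)) ?i_inj ?capv0 //.
rewrite -[X in (_ + X)%N](limg_dim_eq (f := j)) ?j_inj ?capv0 //.
rewrite -dimv_disjoint_sum; last first.
  apply/eqP; rewrite -subv0; apply/subvP => w /memv_capP[].
  by case/memv_imgP=> u _ -> /memv_imgP[v _]; rewrite iE jE => -[-> _]; exact: mem0v.
congr (\dim _); apply/eqP; rewrite eqEsubv; apply/andP; split.
  apply/subvP => _ /memv_imgP[[u v] _ ->]; rewrite lfunE /= /pmod_sum_fun /=.
  apply/memv_addP; exists (i (pmod_map M pq u)); first by rewrite !memv_img ?memvf.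
  exists (j (pmod_map N pq v)); first by rewrite !memv_img ?memvf.
  by rewrite iE jE; congr pair; rewrite ?addr0 ?add0r.
rewrite subv_add; apply/andP; split; apply/subvP => _ /memv_imgP[_ /memv_imgP[u _ ->] ->].
  apply/memv_imgP; exists (u, 0); first exact: memvf.
  by rewrite lfunE iE /= /pmod_sum_fun /= linear0.
apply/memv_imgP; exists (0, u); first exact: memvf.
by rewrite lfunE jE /= /pmod_sum_fun /= linear0.
Qed.

Lemma pmod_rank_interval (J : Defs.interval P) p q (pq : (p <= q)%O) :
  pmod_rank (interval_module F J) pq
  = ((p \in (J : set P)) && (q \in (J : set P))).
Proof.
exact: dim_limg_const_mx.
Qed.

Lemma pmod_rank_bigsum (s : seq (Defs.interval P)) p q (pq : (p <= q)%O) :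
  pmod_rank (pmod_bigsum [seq interval_module F J | J <- s]) pq
  = count (fun J : Defs.interval P => (p \in (J : set P)) && (q \in (J : set P))) s.
Proof.
elim: s => [|J s IH]; first exact: pmod_rank0.
by rewrite /= pmod_rank_sum pmod_rank_interval IH.
Qed.

End Rank.

(** * Recovering a multiset of intervals of a chain from rank counts *)

Section Uniqueness.
Variables (d : Order.disp_t) (P : porderType d).
Implicit Types (J : Defs.interval P) (K : set P).
Implicit Types (S T : seq P) (s : seq (Defs.interval P)).

(** Equality of intervals is decided classically, so that membership in sequences of them makes
    sense. *)
HB.instance Definition _ := gen_eqMixin (Defs.interval P).

Definition separates S T K := all [in K] S && ~~ has [in K] T.

Lemma interval_convex J a b c :
  a \in (J : set P) -> b \in (J : set P) -> (a <= c)%O -> (c <= b)%O ->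
  c \in (J : set P).
Proof. by have [_ cvxJ _] := intervalP J; rewrite !inE; apply: cvxJ. Qed.

Lemma interval_all_bounds (P_total : total (<=%O : rel P)) a S :
  exists p q : P, (p <= q)%O /\
    forall J, all [in (J : set P)] (a :: S)
              = (p \in (J : set P)) && (q \in (J : set P)).
Proof.
elim: S a => [|b S IH] a.
  by exists a, a; split=> // J; rewrite /= andbT andbb.
have [p [q [pq pqE]]] := IH b.
have allE J : all [in (J : set P)] [:: a, b & S]
    = (a \in (J : set P)) && ((p \in (J : set P)) && (q \in (J : set P))).
  by rewrite -pqE.
have [ap|pa] := orP (P_total a p).
  exists a, q; split=> [|J]; first exact: le_trans ap pq.
  rewrite allE; case: (boolP (a \in _)) => // aJ; case: (boolP (q \in _)) => qJ.
    by rewrite (interval_convex aJ qJ).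
  by rewrite andbF.
have [qa|aq] := orP (P_total q a).
  exists p, a; split=> [|J]; first exact: le_trans pq qa.
  rewrite allE; case: (boolP (a \in _)) => aJ; last by rewrite andbF.
  by case: (boolP (p \in _)) => // pJ; rewrite (interval_convex pJ aJ).
exists p, q; split=> // J; rewrite allE.
case: (boolP (p \in _)) => pJ; last by rewrite andbF.
case: (boolP (q \in _)) => qJ; last by rewrite !andbF.
by rewrite (interval_convex pJ qJ).
Qed.

(** The inclusion-exclusion step: every bar contains [t] or avoids it, so an avoided point can be
    traded for a contained one. *)
Lemma count_separates_cons S t T s :
  (count (fun J => separates S (t :: T) J) s
   + count (fun J => separates (t :: S) T J) s)%N
  = count (fun J => separates S T J) s.
Proof.
elim: s => //= J s <-; rewrite addnACA; congr addn.
rewrite /separates /=.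
by case: (t \in _); case: all; case: has.
Qed.

(** For each [J] of [s] other than [K], a point where the two differ goes into [S] if it lies in [K]
    and into [T] otherwise. The fixed [a] keeps the list of contained points nonempty, as
    [interval_all_bounds] requires. *)
Lemma exists_separates K s : K !=set0 -> exists a S T, separates (a :: S) T K /\
  forall K', K' \in [seq interval_set J | J <- s] ->
    separates (a :: S) T K' -> K' = K.
Proof.
case=> a /mem_set aK; exists a; elim: s => [|J s [S [T [KST sepJ]]]].
  by exists [::], [::]; split=> //; rewrite /separates /= aK.
have [JK|JK] := pselect ((J : set P) = K).
  by exists S, T; split=> // K'; rewrite inE => /predU1P[->|/sepJ].
have [p pJK] : exists p, (p \in (J : set P)) != (p \in K).
  apply: contrapT => noP; apply: JK.
  have inE' p : (p \in (J : set P)) = (p \in K).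
    by apply/eqP/negPn/negP => JKp; apply: noP; exists p.
  by apply/seteqP; split=> p /mem_set pX; apply/set_mem; rewrite ?inE' // -inE'.
have [pK|pK] := boolP (p \in K).
  exists (p :: S), T; split=> [|K'].
    by move: KST; rewrite /separates /= aK pK.
  rewrite inE => /predU1P[->|K's].
    by move: pJK; rewrite pK /separates /=;
      case: (p \in interval_set J); rewrite ?andbF.
  move=> sepK'; apply: sepJ => //; move: sepK'; rewrite /separates /=.
  by case: (p \in K') => //=; rewrite andbF.
exists S, (p :: T); split=> [|K'].
  by move: KST; rewrite /separates /= (negPf pK).
rewrite inE => /predU1P[->|K's].
  by move: pJK; rewrite (negPf pK) /separates /=;
      case: (p \in interval_set J); rewrite ?andbF.
move=> sepK'; apply: sepJ => //; move: sepK'; rewrite /separates /=.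
by case: (p \in K') => //=; rewrite andbF.
Qed.

Lemma perm_eq_of_rank (P_total : total (<=%O : rel P)) s1 s2 :
  (forall p q : P, (p <= q)%O ->
     count (fun J => (p \in (J : set P)) && (q \in (J : set P))) s1
     = count (fun J => (p \in (J : set P)) && (q \in (J : set P))) s2) ->
  perm_eq [seq interval_set J | J <- s1] [seq interval_set J | J <- s2].
Proof.
move=> rankE.
have sepE a S T : count (fun J => separates (a :: S) T J) s1
                = count (fun J => separates (a :: S) T J) s2.
  (* The points of [T] are removed one at a time; once none is left, the count is one of those in
     [rankE]. *)
  elim: T a S => [|t T IH] a S; last first.
    apply: (@addIn (count (fun J => separates [:: t, a & S] T J) s1)).
    by rewrite [in RHS]IH !count_separates_cons.
  have [p [q [pq pqE]]] := interval_all_bounds P_total a S.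
  have sep_pq : (fun J => separates (a :: S) [::] J)
      =1 (fun J => (p \in (J : set P)) && (q \in (J : set P))).
    by move=> J; rewrite /separates pqE /= andbT.
  by rewrite !(eq_count sep_pq) rankE.
apply/allP => K; rewrite -map_cat => Ks /=; rewrite !count_map.
have K0 : K !=set0 by case/mapP: Ks => J _ ->; case: (intervalP J).
have [a [S [T [sepK sepJ]]]] := exists_separates (s1 ++ s2) K0.
(* Among the listed bars, being separated by [a :: S] and [T] means being [K], so the multiplicity
   of [K] is a count already compared. *)
have sep_eq s : {subset s <= s1 ++ s2} ->
    count (preim (@interval_set _ P) (pred1 K)) s
    = count (fun J => separates (a :: S) T J) s.
  move=> ss; apply: eq_in_count => J /ss Js /=; apply/eqP/idP => [-> //|].
  by apply: sepJ; exact: map_f.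
by rewrite !sep_eq ?sepE // => J Js; rewrite mem_cat Js ?orbT.
Qed.
End Uniqueness.

(** * Isomorphisms onto sums of interval modules from pointwise bases *)

Section ScaledRowSum.
Variables (F : fieldType) (V : vectType F) (n : nat) (g : V).

(** For [n] at most 1 this sends the generator, if there is one, to [g]; summing the entries avoids
    naming an index that exists only when [n] is 1. *)
Definition row_sum_scale (v : 'rV[F]_n) : V := (\sum_k v 0 k) *: g.

Fact row_sum_scale_linear : linear row_sum_scale.
Proof.
move=> a u v; rewrite /row_sum_scale scalerA -scalerDl; congr (_ *: _).
by rewrite mulr_sumr -big_split; apply: eq_bigr => k _; rewrite !mxE.
Qed.

HB.instance Definition _ :=
  GRing.isLinear.Build F 'rV[F]_n V _ row_sum_scale row_sum_scale_linear.

End ScaledRowSum.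

(** With [n] a boolean, the factor [n] tells whether an internal map of [interval_module] keeps the
    row sum or kills it. *)
Lemma row_sum_const_mx (F : fieldType) m n (v : 'rV[F]_m) :
  \sum_k (v *m (const_mx 1 : 'M[F]_(m, n))) 0 k = (\sum_k v 0 k) *+ n.
Proof.
under eq_bigr => k _ do
  (rewrite mxE; under eq_bigr => j _ do rewrite mxE mulr1).
by rewrite sumr_const card_ord.
Qed.

Lemma row_bool_eq0 (F : fieldType) (b : bool) (v : 'rV[F]_b) :
  (b -> \sum_k v 0 k = 0) -> v = 0.
Proof.
case: b v => v v0; apply/rowP; last by case.
by move=> k; rewrite mxE -[RHS]v0 // big_ord1 ord1.
Qed.

Section IntervalDecomposition.
Variables (F : fieldType) (d : Order.disp_t) (P : porderType d).
Implicit Types M N : pmod F P.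

Lemma pmod_iso_sym M N : pmod_iso M N -> pmod_iso N M.
Proof.
case=> phi [phi_bij phi_nat].
have phiK p : cancel (phi p) (phi p)^-1%VF.
  by apply: lker0_lfunK; apply/lker0P/bij_inj.
have phiVK p : cancel (phi p)^-1%VF (phi p).
  by case: (phi_bij p) => psi _ psiK v; rewrite -[v]psiK phiK.
exists (fun p => (phi p)^-1%VF); split=> [p|p q pq]; first by exists (phi p).
apply/lfunP => v; rewrite !comp_lfunE; apply: (can_inj (phiK q)).
by rewrite phiVK -!comp_lfunE phi_nat !comp_lfunE phiVK.
Qed.

(** The generator of the summand [i] is sent to [g i p]. Vanishing off [J i] and compatibility with
    the internal maps make this natural, spanning makes it onto, and independence makes it
    injective. *)
Lemma pmod_iso_of_interval_basis (I : eqType) (t : seq I)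
    (J : I -> Defs.interval P) M (g : I -> forall p, M p) :
  uniq t ->
  (forall i p, i \in t -> p \notin (J i : set P) -> g i p = 0) ->
  (forall i p q (pq : (p <= q)%O), i \in t -> p \in (J i : set P) ->
     pmod_map M pq (g i p) = g i q) ->
  (forall p, (fullv <= <<[seq g i p | i <- t]>>)%VS) ->
  (forall p c, \sum_(i <- t) c i *: g i p = 0 ->
     forall i, i \in t -> p \in (J i : set P) -> c i = 0) ->
  pmod_iso M (pmod_bigsum [seq interval_module F (J i) | i <- t]).
Proof.
move=> t_uniq g0 g_nat g_span g_free; apply: pmod_iso_sym.
(* Spanning does not pass to sublists, so the induction on [t] proves only naturality, the shape of
   the values and that each [g i p] is attained. *)
suff [psi [psi_nat psi_coef psi_im]] :
    exists psi : forall p,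
      'Hom(pmod_bigsum [seq interval_module F (J i) | i <- t] p, M p),
    [/\ forall p q (pq : (p <= q)%O) z,
          psi q (pmod_map (pmod_bigsum _) pq z) = pmod_map M pq (psi p z),
        forall p z, exists c, psi p z = \sum_(i <- t) c i *: g i p /\
          ((forall i, i \in t -> p \in (J i : set P) -> c i = 0) -> z = 0)
      & forall p i, i \in t -> exists z, psi p z = g i p].
  exists psi; split=> [p|p q pq]; last first.
    by apply/lfunP => z; rewrite !comp_lfunE psi_nat.
  have psi_inj : lker (psi p) == 0%VS.
    rewrite -subv0; apply/subvP => z; rewrite memv_ker memv0 => /eqP.
    have [c [-> c0]] := psi_coef p z.
    by move=> /g_free/c0 ->.
  have psi_full : limg (psi p) = fullv.
    apply/eqP; rewrite eqEsubv subvf (subv_trans (g_span p)) //.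
    apply/span_subvP => _ /mapP[i it ->]; have [z <-] := psi_im p i it.
    by rewrite memv_img ?memvf.
  exists (psi p)^-1%VF; first exact: lker0_lfunK.
  by move=> v; rewrite limg_lfunVK // psi_full memvf.
elim: t t_uniq g0 g_nat {g_span g_free} => [_ _ _|i t IH /= /andP[it t_uniq] g0 g_nat].
  exists (fun p => 0); split=> // p => [q pq z|z].
    by rewrite !lfunE /= linear0.
  exists (fun=> 0); rewrite big_nil lfunE; split=> // _.
  by apply/rowP; case.
have [//|j p jt|j p q pq jt|psi [psi_nat psi_coef psi_im]] := IH.
- by apply: g0; rewrite inE jt orbT.
- by apply: g_nat; rewrite inE jt orbT.
have {}g0 p : p \notin (J i : set P) -> g i p = 0 by apply: g0; exact: mem_head.
have {}g_nat p q (pq : (p <= q)%O) :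
    p \in (J i : set P) -> pmod_map M pq (g i p) = g i q.
  by apply: g_nat; exact: mem_head.
set N := pmod_bigsum _ in psi psi_nat psi_coef psi_im *.
pose psi' p : 'Hom(pmod_sum (interval_module F (J i)) N p, M p) :=
  ((linfun (row_sum_scale (g i p)) \o linfun fst) + (psi p \o linfun snd))%VF.
have psi'E p z : psi' p z = (\sum_k z.1 0 k) *: g i p + psi p z.2.
  by rewrite !lfunE /= !lfunE /= !lfunE.
exists psi'; split.
- move=> p q pq [v z].
  have -> : pmod_map (pmod_sum (interval_module F (J i)) N) pq (v, z)
    = (v *m const_mx 1, pmod_map N pq z).
    by rewrite lfunE /= /pmod_sum_fun /= lfunE.
  rewrite !psi'E /= psi_nat linearD linearZ /= row_sum_const_mx.
  (* Outside [J i] the row [v] has length 0, so its sum is empty. *)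
  have : p \notin (J i : set P) -> \sum_k v 0 k = 0.
    by move=> pJ; apply: big1 => k _; have := ltn_ord k; rewrite {2}(negPf pJ).
  move: (\sum_k v 0 k) => s s0; congr (_ + _).
  have [pJ|/s0 ->] := boolP (p \in (J i : set P)); last by rewrite mul0rn !scale0r.
  rewrite (g_nat _ _ _ pJ).
  have [qJ|qJ] := boolP (q \in (J i : set P)); first by rewrite mulr1n.
  by rewrite (g0 _ qJ) !scaler0.
- move=> p [v z].
  have [c [psic c0]] := psi_coef p z.
  (* As [i] is not in [t], giving it the coefficient read off [v] does not disturb the others. *)
  exists (fun j => if j == i then \sum_k v 0 k else c j).
  rewrite psi'E big_cons eqxx psic; split.
    congr (_ + _); apply: eq_big_seq => j jt.
    by case: eqP jt it => // -> ->.
  move=> c'0; congr (_, _); last first.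
    apply: c0 => j jt pJ; have := c'0 j; rewrite inE jt orbT => /(_ isT pJ).
    by case: eqP jt it => // -> ->.
  apply: row_bool_eq0 => pJ; have := c'0 i; rewrite inE eqxx; exact.
- move=> p j; rewrite inE => /predU1P[->|/(psi_im p)[z zE]]; last first.
    by exists (0, z); rewrite psi'E /= zE big1 ?scale0r ?add0r // => k _; rewrite mxE.
  exists (const_mx 1, 0); rewrite psi'E /= linear0 addr0.
  under eq_bigr => k _ do rewrite mxE.
  rewrite sumr_const card_ord.
  have [pJ|pJ] := boolP (p \in (J i : set P)); first by rewrite mulr1n scale1r.
  by rewrite (g0 _ pJ) scaler0.
Qed.
End IntervalDecomposition.

(** * Zeroth homology through vertices and edges *)

Section ZerothHomology.
Variables (F : fieldType) (X : finType).
Implicit Types (K L : simplicial_complex X) (a b v : X) (C : {set X}).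

Definition vertex_chain v : chain F X := simplex_chain F [set v]%SET.

Definition vertex_class K v : homology F 0 K :=
  quotv_pi (cycles F 0 K) (boundaries F 0 K) (vertex_chain v).

(** The pairing of [c] with the indicator 0-cochain of [C], which is a cocycle when no edge joins
    [C] to its complement. *)
Definition mass C (c : chain F X) : F^o :=
  \sum_(v in C) (c : {ffun {set X} -> F^o}) [set v]%SET.

Fact mass_linear C : linear (mass C).
Proof.
move=> k c c'; rewrite /mass scaler_sumr -big_split /=.
by apply: eq_bigr => v _; rewrite !ffunE.
Qed.

HB.instance Definition _ C :=
  GRing.isLinear.Build F (chain F X) F^o _ (mass C) (mass_linear C).

Lemma mass_vertex C v : mass C (vertex_chain v) = (v \in C)%:R.
Proof.
rewrite /mass; under eq_bigr => u _ do rewrite ffunE (inj_eq set1_inj).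
have [vC|vC] := boolP (v \in C).
  by rewrite (bigD1 v) //= eqxx big1 ?addr0 // => u /andP[_ /negPf ->].
by rewrite big1 // => u uC; case: eqP => // uv; rewrite -uv uC in vC.
Qed.

Lemma vertex_chain_cycle K v : [set v]%SET \in (K : {set {set X}}) ->
  vertex_chain v \in cycles F 0 K.
Proof.
move=> Kv; rewrite memv_cap memv_ker boundary_simplex /simplex_boundary cards1.
rewrite eqxx andbT; apply/memv_span/map_f.
by rewrite mem_filter cards1 mem_enum.
Qed.

(** The sign [s] depends on the order in which the two vertices are enumerated; only its being
    nonzero matters later. *)
Lemma boundary_edge a b : a != b -> exists2 s : F, s != 0 &
  simplex_boundary F [set a; b]%SET = s *: (vertex_chain b - vertex_chain a).
Proof.
move=> ab; pose i := index a (enum [set a; b]%SET).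
pose j := index b (enum [set a; b]%SET).
exists ((-1) ^+ i); first by rewrite signr_eq0.
have card_ab : #|[set a; b]%SET| = 2%N by rewrite cards2 ab.
rewrite /simplex_boundary card_ab /= big_setU1 ?inE //= big_set1.
rewrite -/i -/j setU1K ?inE // finset.setUC setU1K ?inE 1?eq_sym //.
have j_sign : (-1) ^+ j = - (-1) ^+ i :> F.
  have : i != j.
    apply: contraNneq ab => ij; apply/eqP.
    rewrite -[a](nth_index a (s := enum [set a; b]%SET)) ?mem_enum ?set21 //.
    by rewrite -/i ij nth_index // mem_enum set22.
  have : (i < 2)%N by rewrite -card_ab cardE index_mem mem_enum set21.
  have : (j < 2)%N by rewrite -card_ab cardE index_mem mem_enum set22.
  by case: i j => [|[|//]] [|[|//]] //; rewrite expr0 expr1 ?opprK.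
by rewrite j_sign scalerBr scaleNr.
Qed.

(** Signs are invertible and the degenerate edge [a = b] contributes 0, so differences of endpoints
    span the boundaries. *)
Lemma boundaries0P K (U : {vspace chain F X}) :
  reflect (forall a b, [set a; b]%SET \in (K : {set {set X}}) ->
             vertex_chain b - vertex_chain a \in U)
          (boundaries F 0 K <= U)%VS.
Proof.
rewrite /boundaries /chains limg_span; apply: (iffP span_subvP) => [UK|UK].
  move=> a b Kab; have [->|ab] := eqVneq a b; first by rewrite subrr mem0v.
  have [s s0 sE] := boundary_edge ab.
  rewrite -[_ - _](scalerK s0) -sE -boundary_simplex memvZ // UK //.
  by apply/map_f/map_f; rewrite mem_filter mem_enum Kab cards2 ab.
move=> _ /mapP[_ /mapP[A + ->] ->]; rewrite mem_filter mem_enum.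
case/andP => /cards2P[a [b [ab ->]]] Kab; have [s _ sE] := boundary_edge ab.
by rewrite boundary_simplex sE memvZ ?UK.
Qed.

Lemma vertex_class_edge K a b : [set a; b]%SET \in (K : {set {set X}}) ->
  vertex_class K a = vertex_class K b.
Proof.
move=> Kab; apply/eqP; rewrite eq_sym -subr_eq0 -raddfB; apply/eqP/quotv_pi_ker.
by move: a b Kab; apply/boundaries0P.
Qed.

Lemma vertex_class_connect K a b :
  connect [rel u v | [set u; v]%SET \in (K : {set {set X}})] a b ->
  vertex_class K a = vertex_class K b.
Proof.
case/connectP=> s; elim: s a => [|c s IH] a /= => [_ -> //|].
by case/andP=> /vertex_class_edge -> /IH.
Qed.

(** Vertices span the chains of degree 0, so it suffices to pull [U] back along the projection to
    homology. *)
Lemma homology0_sub K (U : {vspace homology F 0 K}) :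
  (forall v, [set v]%SET \in (K : {set {set X}}) -> vertex_class K v \in U) ->
  (fullv <= U)%VS.
Proof.
move=> KU; apply/subvP => z _; have [c + <-] := quotv_pi_surj z.
rewrite memv_cap => /andP[Kc _].
set f := quotv_pi _ _; suff /subvP/(_ c Kc) : (chains F 0 K <= f @^-1: U)%VS.
  by rewrite -memv_preim.
apply/span_subvP => _ /mapP[A + ->]; rewrite mem_filter mem_enum.
by case/andP => /cards1P[v ->] Kv; rewrite -memv_preim; apply: KU.
Qed.

(** Each edge has both ends in [C] or neither, so the mass kills boundaries and descends to
    homology. *)
Lemma mass_eq0 K C c :
  (forall a b, [set a; b]%SET \in (K : {set {set X}}) -> (a \in C) = (b \in C)) ->
  c \in cycles F 0 K ->
  quotv_pi (cycles F 0 K) (boundaries F 0 K) c = 0 -> mass C c = 0.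
Proof.
move=> CK Kc /eqP; rewrite quotv_pi_eq0 // => cB.
suff /subvP/(_ c cB) : (boundaries F 0 K <= lker (linfun (mass C)))%VS.
  by rewrite memv_ker lfunE => /eqP.
apply/boundaries0P => a b Kab; rewrite memv_ker lfunE /= linearB /=.
by rewrite !mass_vertex (CK a b Kab) subrr.
Qed.

End ZerothHomology.

(** * Rips complexes, blocks and staircase regions *)

Section RipsBlocks.
Variables (R : realType) (X : augMetricSpace R).
Implicit Types (eps sigma : R) (p q : R *p R) (S : {set X}) (a b x y : X).

(** The case [a = b] is included: nonnegativity of the distance gives the bound on [eps] that the
    diagonal pairs require. *)
Lemma rips_edge eps S a b :
  ([set a; b]%SET \in rips_simplices eps S)
  = [&& a \in S, b \in S & mdist a b <= eps].
Proof.
rewrite inE finset.subUset !finset.sub1set -andbA.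
have -> : [set a; b]%SET != finset.set0 by apply/set0Pn; exists a; rewrite finset.set21.
rewrite andTb.
congr (_ && (_ && _)); apply/idP/idP => [/'forall_in_forall_inP dab|ab].
  by apply: dab; [exact: finset.set21|exact: finset.set22].
have eps0 : 0 <= eps := le_trans (mdist_ge0 a b) ab.
apply/'forall_in_forall_inP => c + c'; rewrite !finset.in_set2.
by move=> /pred2P[]-> /pred2P[]->; rewrite ?mdistxx // metric_sym.
Qed.

Lemma rips_vertex eps S x :
  ([set x]%SET \in rips_simplices eps S) = (x \in S) && (0 <= eps).
Proof. by rewrite -[[set x]%SET]finset.setUid rips_edge mdistxx andbA andbb. Qed.

Lemma rips_edgeC eps S :
  symmetric [rel a b : X | [set a; b]%SET \in rips_simplices eps S].
Proof. by move=> a b /=; rewrite finset.setUC. Qed.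

Lemma blockE sigma eps x y : (y \in block sigma eps x)
  = connect [rel a b | [set a; b]%SET \in rips_simplices eps (sublevel X sigma)] x y.
Proof.
by rewrite inE; apply: eq_connect => a b; rewrite /= rips_edge.
Qed.

Lemma block_refl sigma eps x : x \in block sigma eps x.
Proof. by rewrite inE connect0. Qed.

Lemma block_edge sigma eps x a b :
  [set a; b]%SET \in rips_simplices eps (sublevel X sigma) ->
  (a \in block sigma eps x) = (b \in block sigma eps x).
Proof.
move=> ab; rewrite !blockE.
by apply: (same_connect_r (sym_connect_sym (rips_edgeC _ _))); apply: connect1.
Qed.

Lemma block_sublevel sigma eps x y :
  x \in sublevel X sigma -> y \in block sigma eps x -> y \in sublevel X sigma.
Proof.
move=> xS; rewrite inE => /connectP[s + ->].
elim: s x xS => //= a s IH x xS /andP[/and3P[_ aS _]]; exact: IH.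
Qed.

Lemma sublevel_le p q x : (p <= q)%O ->
  x \in sublevel X p.1 -> x \in sublevel X q.1.
Proof. by case/andP=> pq _; rewrite !inE => /le_trans; apply. Qed.

Lemma block_le p q x y : (p <= q)%O ->
  y \in block p.1 p.2 x -> y \in block q.1 q.2 x.
Proof.
move=> pq; rewrite !inE; apply: connect_sub => a b /and3P[aS bS ab].
apply: connect1; rewrite /= !(sublevel_le pq) //=.
by case/andP: pq => _; apply: le_trans.
Qed.

Section Elder.
Variables (lt : rel X) (lt_total : strict_total_order lt) (lt_f : compatible lt).
Variables (L : set (R *p R)).

Lemma compatible_le x y : lt x y -> aug_fun x <= aug_fun y.
Proof.
move=> xy; rewrite leNgt; apply/negP => /lt_f yx.
by have [irr trans _] := lt_total; have := irr x; rewrite (trans y x x xy yx).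
Qed.

(** Nonnegativity of the scale and membership in the sublevel set persist upward from [p];
    minimality persists downward from [r], because blocks grow with the parameters. *)
Lemma stair_convex x p q r : (p <= q)%O -> (q <= r)%O ->
  stair lt x p -> stair lt x r -> stair lt x q.
Proof.
move=> pq qr [p0 xp _] [_ _ x_min]; split.
- by case/andP: pq => _; apply: le_trans.
- exact: sublevel_le pq xp.
- by move=> y /(block_le qr)/x_min.
Qed.

Lemma notin_stair x p : 0 <= p.2 -> x \in sublevel X p.1 -> ~ stair lt x p ->
  exists2 y, y \in block p.1 p.2 x & lt y x.
Proof.
move=> p0 xp xNp; apply: contrapT => no_y; apply: xNp; split=> // y xy yx.
have [_ _ lt_tot] := lt_total; have /orP[ltyx|//] := lt_tot _ _ yx.
by case: no_y; exists y.
Qed.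

Lemma stair_interval x :
  total (<=%O : rel {p : R *p R | p \in L}) ->
  slice L (stair lt x) !=set0 -> is_interval (slice L (stair lt x)).
Proof.
move=> L_total x0; split=> // [a b c xa xb ac cb|a b xa xb].
  exact: stair_convex ac cb xa xb.
(* Points of a chain are comparable, so a path of one step suffices. *)
exists [:: b]; split=> //=; last by rewrite andbT; exact: L_total.
by move=> c; rewrite inE => /eqP ->.
Qed.

(* The candidates at the various points of the chain [L] are nested, so a
   candidate at a point where they are fewest works at every point. *)
Lemma exists_elder x : total (<=%O : rel {p : R *p R | p \in L}) ->
  exists o : option X, (forall y, o = Some y -> lt y x) /\
    forall p, L p -> 0 <= p.2 -> x \in sublevel X p.1 -> ~ stair lt x p ->
      exists2 y, o = Some y & y \in block p.1 p.2 x.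
Proof.
move=> L_total.
pose dead (p : R *p R) := [/\ L p, 0 <= p.2, x \in sublevel X p.1 & ~ stair lt x p].
pose older (p : R *p R) := [set y in block p.1 p.2 x | lt y x]%SET.
have olderE p y : (y \in older p) = (y \in block p.1 p.2 x) && lt y x.
  by rewrite finset.in_set.
have [no_dead|dead0] := pselect (forall p, ~ dead p).
  by exists None; split=> // p Lp p0 xp xNp; case: (no_dead p).
have ex_card : exists n, `[< exists2 p, dead p & #|older p| = n >].
  apply: contrapT => no_n; apply: dead0 => p dead_p; apply: no_n.
  by exists #|older p|; apply/asboolP; exists p.
have [_ /asboolP[p dead_p <-] p_min] := ex_minnP ex_card.
have older_sub q : dead q -> older p \subset older q.
  move=> dead_q; have older_le r s : (r <= s)%O -> older r \subset older s.
    move=> rs; apply/fintype.subsetP => y; rewrite !olderE => /andP[+ ->].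
    by rewrite andbT; apply: block_le.
  have Lp : p \in L by case: dead_p => /mem_set.
  have Lq : q \in L by case: dead_q => /mem_set.
  have [/older_le //|/older_le qp] := orP (L_total (exist _ p Lp) (exist _ q Lq)).
  (* Here [older q] lies inside [older p], and minimality of the cardinality forces equality. *)
  have /eqP -> // : older q == older p.
  by rewrite eqEcard qp p_min //; apply/asboolP; exists q.
have [_ p0 xp xNp] := dead_p; have [y xy yx] := notin_stair p0 xp xNp.
exists (Some y); split=> [_ [<-] //|q Lq q0 xq xNq]; exists y => //.
have /fintype.subsetP/(_ y) : older p \subset older q by apply: older_sub.
by rewrite !olderE xy yx => /(_ isT) /andP[].
Qed.

End Elder.
End RipsBlocks.

(** * Induction and maxima in finite strict total orders *)

Lemma strict_total_order_ind (T : finType) (r : rel T) (Q : T -> Prop) :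
  strict_total_order r -> (forall x, (forall y, r y x -> Q y) -> Q x) ->
  forall x, Q x.
Proof.
case=> irr trans _ QI x; have [n] := ubnP #|[set y | r y x]%SET|.
elim: n x => // n IH x xn; apply: QI => y yx; apply: IH.
rewrite ltnS in xn; apply: leq_trans xn; apply: proper_card; apply/properP; split.
  by apply/fintype.subsetP => z; rewrite !finset.in_set => /trans; apply.
by exists y; rewrite !finset.in_set ?irr.
Qed.

(** By induction along the reversed order: without a maximum, [Q] would fail everywhere. *)
Lemma strict_total_order_max (T : finType) (r : rel T) (Q : pred T) x :
  strict_total_order r -> Q x -> exists2 y, Q y & forall z, Q z -> ~~ r y z.
Proof.
move=> r_total Qx; apply: contrapT => no_max.
have [irr trans tot] := r_total.
have r_total' : strict_total_order (fun a b => r b a).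
  split=> // [a b c ba ac|a b ab]; first exact: trans ac ba.
  by rewrite orbC; exact: tot.
suff : ~ Q x by [].
apply: (strict_total_order_ind (Q := fun x => ~ Q x) r_total') => y IH Qy.
apply: no_max.
exists y => // z Qz; apply/negP => yz; exact: IH yz Qz.
Qed.

(** * The interval basis given by the elder rule on a chain *)

Section ElderBasis.
Variables (R : realType) (F : fieldType) (X : augMetricSpace R).
Variables (lt : rel X) (lt_total : strict_total_order lt) (lt_f : compatible lt).

(** The classes relative to elders satisfy the criterion [pmod_iso_of_interval_basis]. A point of
    [L] supplies the default value of [J]. *)
Lemma elder_barcode (L : set (R *p R)) :
  L !=set0 -> total (<=%O : rel {p : R *p R | p \in L}) ->
  is_barcode (pmod_restr (homology_pmod F 0 (rips_bifiltration X)) L)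
    [seq J <- [seq slice L J | J <- elder_rule_staircode lt] | J != set0].
Proof.
case=> p0 Lp0 L_total.
pose A x := slice L (stair lt x).
have /choice[J JE] : forall x, exists K : Defs.interval {p : R *p R | p \in L},
    A x !=set0 -> (K : set _) = A x.
  move=> x.
  have [Ax|Ax] := pselect (A x !=set0).
    by exists (Defs.Interval (stair_interval L_total Ax)).
  (* [J x] is arbitrary for the vertices whose slice is empty. *)
  have p0_interval : is_interval [set exist (fun p => p \in L) p0 (mem_set Lp0)].
    split; first by exists (exist _ p0 (mem_set Lp0)).
    - by move=> a b c /= -> -> ac cb; apply/le_anti/andP.
    - by move=> a b /= -> ->; exists [::].
  by exists (Defs.Interval p0_interval) => /Ax.
have [o oP] := choice (fun x => exists_elder lt_total x L_total).
pose t := [seq x <- enum X | A x != set0].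
have t_uniq : uniq t by rewrite filter_uniq ?enum_uniq.
have tP x : x \in t -> A x !=set0.
  by rewrite mem_filter => /andP[/set0P].
exists [seq J x | x <- t]; split.
  have -> : [seq interval_set K | K <- [seq J x | x <- t]] = [seq A x | x <- t].
    by rewrite -map_comp; apply/eq_in_map => x /tP/JE.
  by rewrite /elder_rule_staircode -map_comp filter_map.
rewrite -map_comp.
pose rel_chain x : chain F X :=
  vertex_chain F x - oapp (@vertex_chain F X) 0 (o x).
pose K (p : {p : R *p R | p \in L}) := rips (val p).2 (sublevel X (val p).1).
pose cls p := quotv_pi (cycles F 0 (K p)) (boundaries F 0 (K p)).
(* Off the interval [rel_chain x] need not be a cycle of [K p], so the value 0 is imposed there. *)
pose g x p : homology F 0 (K p) :=
  if p \in (J x : set _) then cls p (rel_chain x) else 0.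
have aliveP x p : x \in t -> reflect (stair lt x (val p)) (p \in (J x : set _)).
  by move=> /tP/JE ->; apply: (iffP idP) => [/set_mem|?]; [|apply/mem_set].
have alive_t x (p : {p : R *p R | p \in L}) : stair lt x (val p) -> x \in t.
  by move=> px; rewrite mem_filter mem_enum andbT; apply/set0P; exists p.
have LK p q : (p <= q)%O -> (K p : {set {set X}}) \subset K q.
  exact: rips_bi_sub.
(* By compatibility the elder of [x] enters no later than [x], so it is present wherever [x] is. *)
have rel_cycle x p : stair lt x (val p) -> rel_chain x \in cycles F 0 (K p).
  case=> p_ge0 xp _; apply: memvB.
    by apply: vertex_chain_cycle; rewrite rips_vertex xp.
  case oE: (o x) => [y|]; last exact: mem0v.
  apply: (@vertex_chain_cycle F X (K p) y); rewrite rips_vertex p_ge0 andbT inE.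
  have /(compatible_le lt_total lt_f) yx := (oP x).1 y oE.
  by move: xp; rewrite inE; apply: le_trans.
have clsE x p : cls p (rel_chain x) = vertex_class F (K p) x
    - oapp (vertex_class F (K p)) 0 (o x).
  by rewrite /cls raddfB; congr (_ - _); case: (o x) => //=; exact: raddf0.
have cls_block x y p : y \in block (val p).1 (val p).2 x ->
    vertex_class F (K p) x = vertex_class F (K p) y.
  by rewrite blockE; exact: (@vertex_class_connect F X (K p) x y).
apply: (@pmod_iso_of_interval_basis F _ _ X t J
  (pmod_restr (homology_pmod F 0 (rips_bifiltration X)) L) g).
- exact: t_uniq.
- by move=> x p xt px; rewrite /g (negPf px).
- move=> x p q pq xt; rewrite /g => px; rewrite px.
  have {}px := aliveP x p xt px.
  have -> : pmod_map (pmod_restr (homology_pmod F 0 (rips_bifiltration X)) L) pq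
      (cls p (rel_chain x)) = cls q (rel_chain x).
    by apply: quotv_map_pi; [apply/boundariesS/LK|exact: rel_cycle].
  (* If [x] is no longer minimal at [q], its elder lies in its block there and the two classes
     cancel. *)
  case: (aliveP x q xt) => // qx; rewrite clsE.
  have Lq : L (val q) by apply: set_mem; exact: valP.
  have [p_ge0 xp _] := px.
  have q_ge0 : 0 <= (val q).2 by case/andP: pq => _; apply: le_trans.
  have xq := sublevel_le pq xp.
  have [y -> /cls_block ->] := (oP x).2 (val q) Lq q_ge0 xq qx.
  exact: subrr.
(* Spanning goes from older to younger vertices: for a minimal [v], subtracting [g v p] from its
   class leaves that of its elder or 0, and any other vertex shares the class of an older one. *)
- move=> p; apply: homology0_sub => v; rewrite rips_vertex => /andP[+ p_ge0].
  move: v; apply: (strict_total_order_ind lt_total) => v IH vp.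
  have [px|px] := pselect (stair lt v (val p)).
    have vt := alive_t _ _ px.
    have gE : g v p = vertex_class F (K p) v
        - oapp (vertex_class F (K p)) 0 (o v).
      by rewrite /g -clsE; case: aliveP.
    rewrite -[vertex_class F _ v](subrK (oapp (vertex_class F (K p)) 0 (o v))).
    rewrite -gE; apply: memvD; first exact/memv_span/map_f.
    case oE: (o v) => [y|]; last exact: mem0v.
    have yv := (oP v).1 y oE; apply: IH => //.
    have := compatible_le lt_total lt_f yv.
    by move: vp; rewrite !inE => vp yv'; exact: le_trans yv' vp.
  have [y vy yv] := notin_stair lt_total p_ge0 vp px.
  by rewrite (cls_block _ _ _ vy); apply: IH => //; exact: block_sublevel vy.
- move=> p c c_sum x xt px.
  apply: contrapT => /eqP cx.
  pose Q x := [&& x \in t, p \in (J x : set _) & c x != 0].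
  have [y /and3P[yt py cy] y_max] : exists2 y, Q y & forall z, Q z -> ~~ lt y z.
    by apply: (strict_total_order_max lt_total (x := x)); rewrite /Q xt px cx.
  have {}py := aliveP _ _ yt py.
  have y_older z : lt z y -> z \notin block (val p).1 (val p).2 y.
    move=> zy; apply/negP => yz; have [irr trans _] := lt_total.
    have zNy : z != y by apply: contraTneq zy => ->; rewrite irr.
    have [_ _ /(_ z yz zNy) yz'] := py.
    by have := irr y; rewrite (trans z y y yz' zy).
  (* [y] is the latest vertex with a nonzero coefficient, so its own term is the
     only one with nonzero mass on its block. *)
  pose C := block (val p).1 (val p).2 y.
  have mass_older z : lt z y -> mass C (vertex_chain F z) = 0.
    by move=> zy; rewrite mass_vertex (negPf (y_older z zy)).
  have mass_rel z : z = y \/ lt z y -> mass C (rel_chain z) = mass C (vertex_chain F z).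
    move=> zy; rewrite /rel_chain linearB /=.
    case oE: (o z) => [w|] /=; last by rewrite linear0 subr0.
    rewrite (mass_older w) ?subr0 //.
    have wz := (oP z).1 w oE; have [_ trans _] := lt_total.
    by case: zy => [<- //|zy']; exact: trans wz zy'.
  (* Cutting [c] off outside the intervals makes [r] a cycle; its class is still the given vanishing
     sum, because [g] is 0 there. *)
  pose c' i := if p \in (J i : set _) then c i else 0.
  pose r := \sum_(i <- t) c' i *: rel_chain i.
  have r_cycle : r \in cycles F 0 (K p).
    rewrite /r big_seq; apply: memv_suml => i it; rewrite /c'.
    by case: (aliveP i p it) => ip; rewrite ?scale0r ?mem0v // memvZ ?rel_cycle.
  have r0 : cls p r = 0.
    rewrite -c_sum /r linear_sum; apply: eq_bigr => i _; rewrite linearZ /= /c' /g.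
    by case: (p \in _); rewrite ?scale0r ?scaler0.
  have := @mass_eq0 F X (K p) C r (@block_edge _ _ _ _ y) r_cycle r0.
  rewrite /r linear_sum (bigD1_seq y yt t_uniq) /= big1_seq.
    rewrite addr0 linearZ /= mass_rel; last by left.
    rewrite mass_vertex block_refl /c'; case: (aliveP y p yt) => // _.
    by rewrite -[c y *: _]/(c y * _) mulr1 => /eqP; rewrite (negPf cy).
  (* The other surviving terms come from vertices older than [y], and their chains only involve
     vertices outside the block of [y]. *)
  move=> i /andP[iy it]; rewrite linearZ /= /c'.
  case: ifP => [ip|_]; last by rewrite scale0r.
  have [->|ci] := eqVneq (c i) 0; first by rewrite scale0r.
  have iy' : lt i y.
    have [_ _ tot] := lt_total; have := y_max i; rewrite /Q it ip ci => /(_ isT).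
    by have /orP[//|->] := tot i y iy.
  by rewrite mass_rel ?mass_older ?scaler0 //; right.
Qed.
End ElderBasis.

(** * Uniqueness of barcodes over chains, and lines of positive slope *)

Section BarcodeUniqueness.
Variables (F : fieldType) (d : Order.disp_t) (P : porderType d).
Implicit Types (M : pmod F P) (B : seq (set P)).

Lemma is_barcode_perm M B1 B2 :
  perm_eq B1 B2 -> is_barcode M B2 -> is_barcode M B1.
Proof. by move=> B12 [s [B2s Ms]]; exists s; split=> //; exact: perm_trans B12 B2s. Qed.

(** Both decompositions compute the ranks of [M], and these are the counts that [perm_eq_of_rank]
    compares. *)
Lemma is_barcode_uniq (P_total : total (<=%O : rel P)) M B1 B2 :
  is_barcode M B1 -> is_barcode M B2 -> perm_eq B1 B2.
Proof.
case=> s1 [B1s M1] [s2 [B2s M2]]; apply: (perm_trans B1s).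
rewrite perm_sym; apply: (perm_trans B2s); apply: perm_eq_of_rank => // p q pq.
by rewrite -!(pmod_rank_bigsum F _ pq) -(pmod_rank_iso pq M1) -(pmod_rank_iso pq M2).
Qed.

End BarcodeUniqueness.

(** As the slope is positive, the second coordinate increases with the first, so the order on [L] is
    that of the first coordinates. *)
Lemma positive_slope_line_total (R : realType) (L : set (R *p R)) :
  positive_slope_line L -> total (<=%O : rel {p : R *p R | p \in L}).
Proof.
case=> m [c [m_gt0 LE]] p q.
have lineE (r : {p : R *p R | p \in L}) : (val r).2 = m * (val r).1 + c.
  by have := set_mem (valP r); rewrite {1}LE.
have leE (r s : {p : R *p R | p \in L}) : (r <= s)%O = ((val r).1 <= (val s).1).
  rewrite -[LHS]/(((val r).1 <= (val s).1) && ((val r).2 <= (val s).2)).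
  by rewrite !lineE lerD2r ler_pM2l // andbb.
by rewrite !leE; exact: le_total.
Qed.

Theorem theorem3p7 (R : realType) (F : fieldType) (X : augMetricSpace R)
  (lt : rel X) (lt_total : strict_total_order lt) (lt_f : compatible lt)
  (L : set (R *p R)) (hL : positive_slope_line L)
  (B : seq (set {p : R *p R | p \in L})) :
  is_barcode (pmod_restr (homology_pmod F 0 (rips_bifiltration X)) L) B <->
  perm_eq B [seq J <- [seq slice L J | J <- elder_rule_staircode lt]
            | J != set0].
Proof.
have L_total := positive_slope_line_total hL.
have L_neq0 : L !=set0.
  by case: hL => m [c [_ ->]]; exists (0, c); rewrite /= mulr0 add0r.
have barL := elder_barcode F lt_total lt_f L_neq0 L_total.
split=> [barB|permB]; first exact: is_barcode_uniq L_total _ _ _ barB barL.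
exact: is_barcode_perm permB barL.
Qed.
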